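(* Let $N\ge 3$, let $I_1,\dots,I_N$ be positive integers, and let $\mathcal{X}\in\mathbb{C}^{I_1\times I_2\times I_3\times\cdots\times I_N}$. Then the block-Toeplitz-plus-Hankel matrix of $\mathcal{X}$ is block diagonalizable, and $$\mathrm{btph}(\mathcal{X})=\left(C_{I_N}^*\otimes\cdots\otimes C_{I_3}^*\otimes I_{I_1}\right)\,\mathrm{bdiag}(\mathcal{L}(\mathcal{X}))\,\left(C_{I_N}\otimes\cdots\otimes C_{I_3}\otimes I_{I_2}\right).$$
   Context: Kronecker product: $\otimes$; $C^*$ is the conjugate transpose; $I_{I_1}, I_{I_2}$ as matrices are identity matrices of sizes $I_1$, $I_2$. DCT matrix: $C_n\in\mathbb{R}^{n\times n}$ has entries $(C_n)_{i,j}=\sqrt{\frac{2-\delta_{i,1}}{n}}\cos\left(\frac{(i-1)(2j-1)\pi}{2n}\right)$, $1\le i,j\le n$. $W_n=\mathrm{diag}(C_n(:,1))$ is the diagonal matrix whose diagonal is the first column of $C_n$; $Z_n$ is the $n\times n$ matrix with ones on the first superdiagonal and zeros elsewhere; $M_n=W_n^{-1}C_n(I_n+Z_n)$. $n$-mode product: for $U\in\mathbb{C}^{J\times I_n}$, $(\mathcal{X}\times_n U)_{i_1,\dots,i_{n-1},j,i_{n+1},\dots,i_N}=\sum_{i_n}\mathcal{X}_{i_1,\dots,i_N}U_{j,i_n}$. The operator $\mathcal{L}$ is $\mathcal{L}(\mathcal{A})=\mathcal{A}\times_3 M_{I_3}\times_4 M_{I_4}\times_5\cdots\times_N M_{I_N}$.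 Block-Toeplitz-plus-Hankel matrix, defined recursively: for a matrix $A$ (order 2 tensor) $\mathrm{btph}(A)=A$. For a tensor $\mathcal{X}$ of order $N\ge 3$ with last dimension $n=I_N$, put $\mathcal{X}_k=\mathcal{X}(:,\dots,:,k)$; then $\mathrm{btph}(\mathcal{X})$ is the $n\times n$ block matrix whose $(i,j)$ block is $\mathrm{btph}(\mathcal{X}_{|i-j|+1})+H_{ij}$, where $H_{ij}=\mathrm{btph}(\mathcal{X}_{i+j})$ if $i+j\le n$, $H_{ij}=0$ if $i+j=n+1$, and $H_{ij}=\mathrm{btph}(\mathcal{X}_{2n+2-i-j})$ if $i+j\ge n+2$. Representative matrices: with $P=I_3\cdots I_N$, for $1\le p\le P$ write $p=k_3+\sum_{i=4}^N (k_i-1)\prod_{s=3}^{i-1}I_s$ with $1\le k_i\le I_i$ and set $X^p=\mathcal{X}(:,:,k_3,\dots,k_N)\in\mathbb{C}^{I_1\times I_2}$. Then $\mathrm{bdiag}(\mathcal{X})$ is the block diagonal matrix with diagonal blocks $X^1,\dots,X^P$. *)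

(* Defs.v *)
From mathcomp Require Import all_boot all_order all_algebra.
From mathcomp Require Import complex mxtens.
From mathcomp Require Import reals trigo.

Set Implicit Arguments.
Unset Strict Implicit.
Unset Printing Implicit Defensive.

Import GRing.Theory.
Local Open Scope ring_scope.
Local Open Scope complex_scope.

(* The matrices C_n, W_n, Z_n, M_n. Row and column indices are 0-based, so    *)
(* (i - 1)(2 j - 1) becomes i (2 j + 1). The entries of C_n are given on nat  *)
(* so that the first column can be written for every n, including n = 0.      *)
Section DCT.
Variable R : realType.

Definition dct_coef (n i j : nat) : R :=
  Num.sqrt ((2 - (i == 0)%N%:R) / n%:R) *
  cos ((i * (2 * j + 1))%:R * pi / (2 * n)%:R).

Definition dct (n : nat) : 'M[R]_n := \matrix_(i, j) dct_coef n i j.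

Definition dctW (n : nat) : 'M[R]_n := diag_mx (\row_i dct_coef n i 0).

Definition dctZ (n : nat) : 'M[R]_n := \matrix_(i, j) (j == i.+1 :> nat)%:R.

Definition dctM (n : nat) : 'M[R]_n :=
  invmx (dctW n) *m dct n *m (1%:M + dctZ n).

Definition dctC (n : nat) : 'M[R[i]]_n := map_mx (real_complex R) (dct n).

Definition dctMC (n : nat) : 'M[R[i]]_n := map_mx (real_complex R) (dctM n).

End DCT.

(* The n1 x n2 block matrix with (i, j) block B i j, all blocks being p x q.  *)
Definition block_matrix (C : Type) n1 n2 p q
    (B : 'I_n1 -> 'I_n2 -> 'M[C]_(p, q)) : 'M[C]_(n1 * p, n2 * q) :=
  \matrix_(a, b) B (mxtens_unindex a).1 (mxtens_unindex b).1
                   (mxtens_unindex a).2 (mxtens_unindex b).2.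

(* Dimensions are given by I : nat -> nat, where I n is the dimension I_n of  *)
(* mode n (modes are numbered from 1; only I 1, ..., I N matter at order N).  *)
(* Indices within a mode are 0-based.                                         *)
Section Tensors.
Variables (C : numClosedFieldType) (I : nat -> nat).

(* Multi-indices (i_1, ..., i_N), as left-nested tuples ((tt, i_1), ..., i_N) *)
Fixpoint midx (N : nat) : Type :=
  if N is N'.+1 then (midx N' * 'I_(I N'.+1))%type else unit.

Definition tensor (N : nat) : Type := midx N -> C.

(* X(:, ..., :, k) with k >= 1 counted from 1; the zero tensor if k > I_{N+1}. *)
Definition slice N (X : tensor N.+1) (k : nat) : tensor N :=
  fun i => if insub k.-1 is Some k' then X (i, k') else 0.

(* The n-mode product by a square matrix, entrywise                           *)
(*   (X x_n U)(.., j, ..) = \sum_t X (.., t, ..) * U j t,                     *)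
(* found by descending to mode n, where the equality e : n = N'.+1 is used to *)
(* read U as a matrix indexed by mode N'.+1. It is the identity when n is not *)
(* one of the modes 1, ..., N.                                                *)
Fixpoint mode_prod n (U : 'M[C]_(I n)) N : tensor N -> tensor N :=
  match N with
  | 0 => fun X => X
  | N'.+1 => fun X i =>
      match n =P N'.+1 with
      | ReflectT e =>
          let ord := cast_ord (congr1 I (esym e)) in
          \sum_(t < I N'.+1) X (i.1, t) * U (ord i.2) (ord t)
      | ReflectF _ => mode_prod U (fun i' => X (i', i.2)) i.1
      end
  end.

(* X x_3 F(I_3) x_4 F(I_4) ... x_N F(I_N), with N = m.+2 *)
Definition mode_prods (F : forall n, 'M[C]_n) m (X : tensor m.+2) : tensor m.+2 :=
  foldl (fun A n => mode_prod (F (I n)) A) X (iota 3 m).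

(* I_N * (... * (I_3 * p)), with N = m.+2 *)
Fixpoint bsize (p m : nat) : nat :=
  if m is m'.+1 then (I m'.+3 * bsize p m')%N else p.

Lemma bsizeE p m : (\prod_(3 <= s < m.+3) I s * p)%N = bsize p m.
Proof.
elim: m => [|m IH]; first by rewrite big_geq ?mul1n.
by rewrite big_nat_recr //= -IH mulnAC mulnC.
Qed.

(* F(I_N) (x) ... (x) F(I_3) (x) 1_p, with N = m.+2 *)
Fixpoint kron_modes (F : forall n, 'M[C]_n) p m : 'M[C]_(bsize p m) :=
  if m is m'.+1 then F (I m'.+3) *t kron_modes F p m' else 1%:M.

(* The conditions on i and j are written with 1-based block indices.          *)
Fixpoint btph m : tensor m.+2 -> 'M[C]_(bsize (I 1%N) m, bsize (I 2%N) m) :=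
  match m with
  | 0 => fun X => \matrix_(a, b) X (tt, a, b)
  | m'.+1 => fun X =>
      let n := I m'.+3 in
      block_matrix (fun a b : 'I_n =>
        let i := a.+1 in
        let j := b.+1 in
        btph (slice X (`|i - j|%N + 1)) +
        (if (i + j <= n)%N then btph (slice X (i + j))
         else if (i + j == n + 1)%N then 0
         else btph (slice X (2 * n + 2 - (i + j)))))
  end.

(* Trailing multi-indices (k_3, ..., k_N), with N = m.+2 *)
Fixpoint tidx (m : nat) : finType :=
  if m is m'.+1 then (tidx m' * 'I_(I m'.+3))%type else unit.

Fixpoint join_idx m (a : 'I_(I 1%N)) (b : 'I_(I 2%N)) : tidx m -> midx m.+2 :=
  match m with
  | 0 => fun _ => (tt, a, b)
  | m'.+1 => fun k => (join_idx a b k.1, k.2)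
  end.

(* k_3 + \sum_(4 <= i <= N) (k_i - 1) * \prod_(3 <= s < i) I_s, 0-based *)
Fixpoint lin_idx m : tidx m -> nat :=
  match m with
  | 0 => fun _ => 0%N
  | m'.+1 => fun k => (lin_idx k.1 + k.2 * \prod_(3 <= s < m'.+3) I s)%N
  end.

(* X^p = X(:, :, k_3, ..., k_N) for the (unique) k of linear index p.         *)
Definition rep_mx m (X : tensor m.+2) (p : 'I_(\prod_(3 <= s < m.+3) I s)) :
    'M[C]_(I 1%N, I 2%N) :=
  if [pick k : tidx m | lin_idx k == p] is Some k
  then \matrix_(a, b) X (join_idx a b k) else 0.

Definition bdiag m (X : tensor m.+2) : 'M[C]_(bsize (I 1%N) m, bsize (I 2%N) m) :=
  castmx (bsizeE (I 1%N) m, bsizeE (I 2%N) m)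
    (block_matrix (fun p q => if p == q then rep_mx X p else 0)).

End Tensors.

(* L(X) = X x_3 M_{I_3} x_4 ... x_N M_{I_N} *)
Definition dct_transform (R : realType) (I : nat -> nat) m
    (X : tensor R[i] I m.+2) : tensor R[i] I m.+2 :=
  mode_prods (@dctMC R) X.

(* Main.v *)
(* The DCT matrix C_n is orthogonal, its entries being samples of cosines. By  *)
(* cos (x + y) + cos (x - y) = 2 cos x cos y, M_n has entries 1 in column 0    *)
(* and 2 cos (2 r k pi / 2n) elsewhere, so multiplying row r of column a of    *)
(* C_n by (M_n)_{r,k} adds the columns a + k and a - k, where columns are      *)
(* extended by even reflection about both ends. Hence C_n^T diag(M_n e_k) C_n  *)
(* is the Toeplitz-plus-Hankel pattern of e_k. The theorem follows by          *)
(* induction on the order: with X_t the slab of X at last index t, btph(X) is  *)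
(* the sum over t of this pattern tensored with btph(X_t), and bdiag(L(X)) the *)
(* sum of diag(M_n e_t) tensored with bdiag(L(X_t)).                           *)
Require Import Defs.
From mathcomp Require Import all_boot all_order all_algebra.
From mathcomp Require Import zify ring lra.
From mathcomp Require Import boolp.
From mathcomp Require Import complex mxtens spectral.
From mathcomp Require Import reals trigo.

Set Implicit Arguments.
Unset Strict Implicit.
Unset Printing Implicit Defensive.

Import Order.TTheory GRing.Theory Num.Theory.

Local Open Scope ring_scope.

(** Everything rests on one real identity, [dct_conj_diag_dctM]: conjugating by C_n the diagonal
    matrix built from column [k] of M_n marks the block positions at which slice [k] enters [btph].
    It combines the product formula for cosines ([dct_coef_mul_dctM]) with orthogonality of the
    columns extended by reflection ([sum_dct_coef_col]). [btph_slab] and [bdiag_mode_prods] split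
    both sides along the last mode into sums of Kronecker products. These multiply factor by factor,
    so in [btph_bdiag] the first factors agree by that identity and the second ones by induction on
    the order. *)

Section CosineTransform.
Variable R : realType.
Implicit Types (n i j k u : nat).

(** * Orthogonality of the DCT matrix *)

Lemma sum_cos_odd_multiples n (x : R) :
  (sin x * \sum_(j < n) cos ((2 * j + 1)%:R * x)) *+ 2 = sin ((2 * n)%:R * x).
Proof.
elim: n => [|n IHn]; first by rewrite big_ord0 mulr0 mul0rn muln0 mul0r sin0.
rewrite big_ord_recr /= mulrDr mulrnDl IHn.
have -> : (2 * n.+1)%:R * x = (2 * n + 1)%:R * x + x by ring.
(* The sum telescopes: 2 sin x cos ((2n+1)x) is sin ((2n+2)x) - sin (2nx). *)
have -> : (2 * n)%:R * x = (2 * n + 1)%:R * x - x by ring.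
by rewrite sinB sinD; ring.
Qed.

Lemma sum_cos_dct_eq0 n u : (0 < u < 2 * n)%N ->
  \sum_(j < n) cos ((u * (2 * j + 1))%:R * pi / (2 * n)%:R) = 0 :> R.
Proof.
move=> /andP[u_gt0 u_lt]; pose x : R := u%:R * pi / (2 * n)%:R.
have n0 : (2 * n)%:R != 0 :> R by rewrite pnatr_eq0; lia.
have := sum_cos_odd_multiples n x.
have -> : (2 * n)%:R * x = pi *+ u by rewrite mulrC divfK ?mulr_natl.
have sinpiM k : sin (pi *+ k) = 0 :> R.
  by elim: k => [|k IHk]; rewrite ?mulr0n ?sin0 // mulrSr sinDpi IHk oppr0.
(* The closed form is sin (u pi) = 0, and sin x is nonzero because 0 < x < pi. *)
rewrite sinpiM => /eqP; rewrite mulrn_eq0 /= mulf_eq0.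
have sinx : 0 < sin x.
  apply: sin_gt0_pi; rewrite divr_gt0 ?mulr_gt0 ?ltr0n ?pi_gt0 //=; last by lia.
  by rewrite ltr_pdivrMr ?ltr0n ?[_ * pi]mulrC ?ltr_pM2l ?pi_gt0 ?ltr_nat //; lia.
rewrite gt_eqF //= => /eqP sum0; rewrite -[RHS]sum0; apply: eq_bigr => j _.
by congr cos; rewrite /x natrM; ring.
Qed.

Lemma dct_coef_orthonormal_rows n i k : (i < n)%N -> (k < n)%N ->
  \sum_(j < n) dct_coef R n i j * dct_coef R n k j = (i == k)%:R.
Proof.
(* With [k <= i] the frequency [i - k] in the product formula is a genuine natural number. *)
wlog le_ki : i k / (k <= i)%N => [hw ltin ltkn|ltin ltkn].
  have [/hw-> //|/ltnW/hw hw'] := leqP k i.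
  by rewrite eq_sym -hw' //; apply: eq_bigr => j _; rewrite mulrC.
pose s (m : nat) : R := Num.sqrt ((2 - (m == 0)%:R) / n%:R).
pose c u : R := \sum_(j < n) cos ((u * (2 * j + 1))%:R * pi / (2 * n)%:R).
have n0 : n%:R != 0 :> R by rewrite pnatr_eq0; lia.
have -> : \sum_(j < n) dct_coef R n i j * dct_coef R n k j
    = s i * s k / 2 * (c (i + k)%N + c (i - k)%N).
  rewrite -big_split mulr_sumr; apply: eq_bigr => j _ /=.
  rewrite /dct_coef -!/(s _).
  have -> : ((i + k) * (2 * j + 1))%:R * pi / (2 * n)%:R =
    (i * (2 * j + 1))%:R * pi / (2 * n)%:R + (k * (2 * j + 1))%:R * pi / (2 * n)%:R :> R.
    by rewrite mulnDl natrD; ring.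
  have -> : ((i - k) * (2 * j + 1))%:R * pi / (2 * n)%:R =
    (i * (2 * j + 1))%:R * pi / (2 * n)%:R - (k * (2 * j + 1))%:R * pi / (2 * n)%:R :> R.
    by rewrite mulnBl natrB ?leq_mul2r ?le_ki ?orbT //; ring.
  by rewrite cosB cosD; field.
have c0 : c 0 = n%:R.
  rewrite /c (eq_bigr (fun=> 1)) ?sumr_const ?card_ord // => j _.
  by rewrite mul0n !mul0r cos0.
have cN0 u : (0 < u < 2 * n)%N -> c u = 0 by exact: sum_cos_dct_eq0.
have ss (m : nat) : s m * s m = (2 - (m == 0)%:R) / n%:R.
  by rewrite -expr2 sqr_sqrtr // divr_ge0 // subr_ge0 ler_nat; case: (m == 0).
have [->|neq_ik] := eqVneq i k; last by rewrite !cN0 ?addr0 ?mulr0 //; lia.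
rewrite subnn c0 ss; have [->|k0] := eqVneq k 0%N.
  by rewrite addn0 c0 /=; field.
by rewrite cN0 ?add0r ?subr0 /=; [field|lia].
Qed.

Lemma dct_mul_tr n : dct R n *m (dct R n)^T = 1%:M.
Proof.
apply/matrixP => i k; rewrite !mxE.
rewrite -[RHS](dct_coef_orthonormal_rows (ltn_ord i) (ltn_ord k)).
by apply: eq_bigr => j _; rewrite !mxE.
Qed.

Lemma dct_tr_mul n : (dct R n)^T *m dct R n = 1%:M.
Proof. exact/mulmx1C/dct_mul_tr. Qed.

(** * Entries of M_n and the one-mode diagonalization *)

Lemma dct_coef_reflect n i j : (j < 2 * n)%N ->
  dct_coef R n i (2 * n - j.+1) = dct_coef R n i j.
Proof.
move=> ltj; rewrite /dct_coef; congr (_ * _).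
have n0 : n%:R != 0 :> R by rewrite pnatr_eq0; lia.
(* Reflecting a column about the right end turns the angle t into 2 pi i - t. *)
have -> : (i * (2 * (2 * n - j.+1) + 1))%:R * pi / (2 * n)%:R =
    - ((i * (2 * j + 1))%:R * pi / (2 * n)%:R) + pi *+ 2 *+ i :> R.
  rewrite -mulrnA -mulr_natl natrM.
  have -> : (2 * (2 * n - j.+1) + 1 = 2 * (2 * n) - (2 * j + 1))%N by lia.
  by rewrite natrB; [field|lia].
rewrite -[RHS]cosN; move: (- _) => y; move: {j ltj} i => i.
by elim: i => [|i IHi]; rewrite ?addr0 // mulrSr addrA cosD2pi.
Qed.

Lemma dctM_entry n (r k : 'I_n) :
  dctM R n r k = if k == 0%N :> nat then 1
                 else cos ((r * (2 * k))%:R * pi / (2 * n)%:R) *+ 2.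
Proof.
have n_gt0 : (0 < n)%N by case: r => *; lia.
have n0 : n%:R != 0 :> R by rewrite pnatr_eq0 -lt0n.
(* The angle of a first-column entry is i pi / 2n, which lies in [0, pi/2); hence W_n is
   invertible. *)
have d0 (i : 'I_n) : dct_coef R n i 0 != 0.
  have ltin := ltn_ord i.
  rewrite gt_eqF // mulr_gt0 //.
    rewrite sqrtr_gt0 divr_gt0 ?ltr0n // subr_gt0.
    by rewrite (@ltr_nat R) ltnS leq_b1.
  have lt_pi : i%:R * pi < n%:R * pi :> R by rewrite ltr_pM2r ?pi_gt0 ?ltr_nat.
  have ge0_pi : 0 <= i%:R * pi :> R by rewrite mulr_ge0 ?pi_ge0.
  have gt0_pi : 0 < n%:R * pi :> R by rewrite mulr_gt0 ?pi_gt0 ?ltr0n.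
  apply: cos_gt0_pihalf; rewrite muln0 add0n muln1.
  have -> : i%:R * pi / (2 * n)%:R = (i%:R * pi / n%:R) / 2 :> R by field.
  rewrite -mulNr ltr_pM2r ?ltr_pM2r ?invr_gt0 // ltr_pdivrMr ?ltr0n //.
  by rewrite [pi * _]mulrC lt_pi andbT ltr_pdivlMr ?ltr0n //; lra.
have unitW : dctW R n \in unitmx.
  rewrite unitmxE det_diag unitfE; apply/prodf_neq0 => i _.
  by rewrite mxE.
have /matrixP/(_ r k) : dctW R n *m dctM R n = dct R n *m (1%:M + dctZ R n).
  by rewrite /dctM mulmxA mulKVmx.
rewrite mul_diag_mx mulmxDr mulmx1 !mxE => /(canRL (mulKf (d0 r))) ->.
apply: (canLR (mulKf (d0 r))).
have [k0|k_neq0] := eqVneq (k : nat) 0%N.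
  rewrite k0 big1 ?addr0 ?mulr1 // => l _; rewrite !mxE k0 /=.
  by rewrite mulr0.
have ltk : (k.-1 < n)%N by have := ltn_ord k; lia.
rewrite (bigD1 (Ordinal ltk)) //= big1 ?addr0 => [|l]; last first.
  rewrite -val_eqE /= !mxE => neq_l.
  by case: eqP => [eq_k|]; rewrite ?mulr0 //; lia.
(* Column [k] of C_n (1 + Z_n) adds columns [k] and [k - 1] of C_n, whose angles are y + x and y - x
   with x the angle in column 0; the factor cos x cancels against W_n. *)
rewrite !mxE /= prednK ?lt0n // eqxx mulr1 /dct_coef -mulrDr -!mulrA; congr (_ * _).
rewrite muln0 add0n muln1; set x : R := r%:R * (pi / _).
set y : R := (r * (2 * k))%:R * _.
have -> : (r * (2 * k + 1))%:R * (pi / (2 * n)%:R) = y + x.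
  by rewrite /y /x; ring.
have -> : (r * (2 * k.-1 + 1))%:R * (pi / (2 * n)%:R) = y - x.
  have -> : (2 * k.-1 + 1 = 2 * k - 1)%N by lia.
  by rewrite /y /x mulnBr natrB ?muln1; [ring|rewrite leq_pmulr; lia].
by rewrite cosB cosD; ring.
Qed.

(** This is 2 cos x cos y = cos (x + y) + cos (x - y). A negative column a - k is reflected about
    the left end to k - a - 1, as cosine is even; a column a + k beyond [n] is left to
    [sum_dct_coef_col]. *)
Lemma dct_coef_mul_dctM n (r k : 'I_n) a : (a < n)%N -> (0 < k)%N ->
  dct_coef R n r a * dctM R n r k =
  dct_coef R n r (a + k)%N +
  dct_coef R n r (if (k <= a)%N then a - k else k - a.+1)%N.
Proof.
move=> lta k0; rewrite dctM_entry gtn_eqF // /dct_coef -mulrDr -!mulrA.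
congr (_ * _); set p : R := pi / _.
set x : R := (r * (2 * a + 1))%:R * p; set y : R := (r * (2 * k))%:R * p.
have -> : (r * (2 * (a + k) + 1))%:R * p = x + y by rewrite /x /y; ring.
suff -> : cos ((r * (2 * (if (k <= a)%N then a - k else k - a.+1)%N + 1))%:R * p)
    = cos (x - y) by rewrite cosB cosD; ring.
rewrite /x /y; case: (leqP k a) => [leka|ltak].
  congr cos; rewrite -(subnK leka); set d := (a - k)%N.
  by rewrite addnK; ring.
rewrite -[RHS]cosN; congr cos; rewrite -(subnK ltak); set d := (k - a.+1)%N.
by rewrite addnK; ring.
Qed.

Lemma sum_dct_coef_col n c b : (c < 2 * n)%N -> (b < n)%N ->
  \sum_(r < n) dct_coef R n r c * dct_coef R n r b =
  (c == b)%:R + (c + b == (2 * n).-1)%N%:R.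
Proof.
have orth a d : (a < n)%N -> (d < n)%N ->
    \sum_(r < n) dct_coef R n r a * dct_coef R n r d = (a == d)%:R.
  move=> lta ltd; have /matrixP/(_ (Ordinal lta) (Ordinal ltd)) := dct_tr_mul n.
  rewrite !mxE -val_eqE /= => <-; apply: eq_bigr => r _; by rewrite !mxE.
move=> ltc ltb; have [ltcn|lenc] := ltnP c n.
  by rewrite orth // [in X in _ + X]ltn_eqF ?addr0 //; lia.
under eq_bigr do rewrite -dct_coef_reflect //.
rewrite orth //; last by lia.
rewrite [c == b]gtn_eqF ?add0r; last by lia.
by congr (_%:R); congr nat_of_bool; lia.
Qed.

(** The three terms are the Toeplitz part and the two branches of the Hankel part. On the
    antidiagonal a + b + 1 = n both Hankel terms ask for k = n, which is out of range, so the zero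
    blocks need no separate case. *)
Lemma dct_conj_diag_dctM n (a b k : 'I_n) :
  ((dct R n)^T *m diag_mx (\row_r dctM R n r k) *m dct R n) a b =
  (k == `|a%:Z - b%:Z|%N :> nat)%:R + (k == a + b + 1 :> nat)%N%:R
  + (k == 2 * n - (a + b + 1) :> nat)%N%:R.
Proof.
have [[lta ltb] ltk] := (ltn_ord a, ltn_ord b, ltn_ord k).
have -> : ((dct R n)^T *m diag_mx (\row_r dctM R n r k) *m dct R n) a b =
    \sum_(r < n) dct_coef R n r a * dctM R n r k * dct_coef R n r b.
  by rewrite mul_mx_diag mxE; apply: eq_bigr => r _; rewrite !mxE.
(* Column 0 of M_n is constantly 1, without the factor 2, so the product formula does not apply to
   it. *)
have [k0|k_neq0] := eqVneq (k : nat) 0%N.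
  under eq_bigr do rewrite dctM_entry k0 eqxx mulr1.
  rewrite sum_dct_coef_col //; last by lia.
  rewrite k0 [(0 == a + b + 1)%N]ltn_eqF ?addn1 // addr0.
  rewrite [(0 == _ - _)%N]ltn_eqF ?[(a + b == _)%N]ltn_eqF; try lia.
  by rewrite !addr0; congr (_%:R); congr nat_of_bool; lia.
under eq_bigr do rewrite dct_coef_mul_dctM ?lt0n // mulrDl.
have lt_if : ((if k <= a then a - k else k - a.+1) < 2 * n)%N by case: ifP; lia.
have lt_add : (a + k < 2 * n)%N by lia.
rewrite big_split /= !sum_dct_coef_col //.
have -> : (a + k + b == (2 * n).-1)%N = (k == 2 * n - (a + b + 1) :> nat)%N by lia.
case: (leqP k a) => [leka|ltak].
  rewrite [(_ + b == _)%N]ltn_eqF ?[(k == a + b + 1 :> nat)%N]ltn_eqF; try lia.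
  have -> : (k == `|a%:Z - b%:Z|%N :> nat) = (a + k == b)%N || (a - k == b)%N by lia.
  have [akb|_] := eqVneq (a + k)%N b; last by rewrite !add0r !addr0 addrC.
  by rewrite [(a - k == b)%N]ltn_eqF ?addr0 //; lia.
rewrite [(_ - _ + b == _)%N]ltn_eqF; last by lia.
have -> : (k - a.+1 == b)%N = (k == a + b + 1 :> nat)%N by lia.
have -> : (k == `|a%:Z - b%:Z|%N :> nat) = (a + k == b)%N by lia.
by rewrite addr0 addrAC.
Qed.

End CosineTransform.

Lemma tens1mx1 (R : pzRingType) m n : 1%:M *t 1%:M = 1%:M :> 'M[R]_(m * n).
Proof.
apply/matrixP => a b; case: (mxtens_indexP a) => i j.
case: (mxtens_indexP b) => k l.
rewrite tensmxE !mxE -natrM mulnb -xpair_eqE.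
by rewrite (inj_eq (can_inj (@mxtens_indexK _ _))).
Qed.

(** * Splitting [bdiag] and [btph] along the last mode *)

Section Tensors.
Variables (C : numClosedFieldType) (I : nat -> nat).
Implicit Type m : nat.

Local Notation slab X t := (fun i => X (i, t)).

(** Products in earlier modes commute with fixing the last index; the last-mode product, applied
    last, only mixes the slabs linearly. *)
Lemma mode_prods_slab (F : forall n, 'M[C]_n) m (X : tensor C I m.+3)
    (r : 'I_(I m.+3)) :
  slab (mode_prods F X) r =
  fun i => \sum_t F (I m.+3) r t * mode_prods F (slab X t) i.
Proof.
have slab_foldl s (Y : tensor C I m.+3) t : all (fun n => n < m.+3)%N s ->
    slab (foldl (fun A n => mode_prod (F (I n)) A) Y s) t =
    foldl (fun A n => mode_prod (F (I n)) A) (slab Y t : tensor C I m.+2) s.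
  elim: s Y => [|n s IHs] Y //= /andP[ltn all_s]; rewrite IHs //; congr foldl.
  by apply: funext => i /=; case: eqP => // en; rewrite en ltnn in ltn.
rewrite /mode_prods; have -> : iota 3 m.+1 = rcons (iota 3 m) m.+3.
  by rewrite -cats1; have := iotaD 3 m 1; rewrite addn1.
rewrite foldl_rcons.
apply: funext => i /=; case: eqP => [e|//]; apply: eq_bigr => t _.
rewrite mulrC (eq_irrelevance e (erefl _)) /= !cast_ord_id; congr (_ * _).
rewrite -[LHS]/((fun i => _ (i, t)) i) slab_foldl //.
by apply/allP => n; rewrite mem_iota => /andP[_].
Qed.

Lemma rep_mx_sum m n (c : 'I_n -> C) (X : 'I_n -> tensor C I m.+2) p :
  rep_mx (fun i => \sum_t c t * X t i) p = \sum_t c t *: rep_mx (X t) p.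
Proof.
rewrite /rep_mx; case: pickP => [k _|_]; last first.
  by rewrite big1 // => t _; rewrite scaler0.
by apply/matrixP => a b; rewrite summxE mxE; apply: eq_bigr => t _; rewrite !mxE.
Qed.

Lemma bdiag_sum m n (c : 'I_n -> C) (X : 'I_n -> tensor C I m.+2) :
  bdiag (fun i => \sum_t c t * X t i) = \sum_t c t *: bdiag (X t).
Proof.
apply/matrixP => a b; rewrite summxE castmxE mxE.
under [RHS]eq_bigr do rewrite mxE castmxE mxE.
case: eqP => [_|_]; last by rewrite mxE big1 // => t _; rewrite mulr0.
by rewrite rep_mx_sum summxE; apply: eq_bigr => t _; rewrite mxE.
Qed.

Lemma ltn_lin_idx m (k : tidx I m) : (lin_idx k < \prod_(3 <= s < m.+3) I s)%N.
Proof.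
elim: m k => [|m IHm] k; first by rewrite big_geq.
case: k => k r /=; rewrite [X in (_ < X)%N]big_nat_recr //= [X in (_ < X)%N]mulnC.
apply: (@leq_trans (r.+1 * \prod_(3 <= s < m.+3) I s)).
  by rewrite mulSn ltn_add2r.
by rewrite leq_mul2r [(r < _)%N]ltn_ord orbT.
Qed.

Lemma lin_idx_inj m : injective (@lin_idx I m).
Proof.
elim: m => [[] []//|m IHm] [k r] [k' r'] /= /eqP.
rewrite [X in X == _]addnC [X in _ == X]addnC eq_addl_mul ?ltn_lin_idx //.
by rewrite xpair_eqE => /andP[/eqP/val_inj-> /eqP/IHm->].
Qed.

(** The last index is the leading digit of the mixed-radix number [lin_idx], and injectivity
    determines what [pick] returns. *)
Lemma rep_mx_slab m (X : tensor C I m.+3) (r : 'I_(I m.+3))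
    (p : 'I_(\prod_(3 <= s < m.+4) I s)) (q : 'I_(\prod_(3 <= s < m.+3) I s)) :
  p = (r * \prod_(3 <= s < m.+3) I s + q)%N :> nat ->
  rep_mx X p = rep_mx (slab X r) q.
Proof.
move=> def_p; rewrite /rep_mx; case: (pickP (fun k : tidx I m => _)) => [k|noq].
  move=> /eqP lin_k; case: pickP => [k'|/(_ (k, r))].
    by rewrite def_p -lin_k addnC => /eqP/(@lin_idx_inj m.+1 _ (k, r))->.
  by rewrite /= def_p lin_k addnC eqxx.
case: pickP => // -[k r'] /=.
rewrite def_p addnC eq_addl_mul ?ltn_lin_idx // xpair_eqE => /andP[_].
by rewrite noq.
Qed.

(** Reconciles the two readings of a row index: the nested one of [bsize] and the flat pair of block
    number and offset behind the cast in [bdiag]. *)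
Lemma unindex_bsizeS p m (r : 'I_(I m.+3)) (a : 'I_(bsize I p m)) :
  let a' := mxtens_unindex (cast_ord (esym (bsizeE I p m)) a) in
  let a'' := mxtens_unindex
    (cast_ord (esym (bsizeE I p m.+1)) (mxtens_index (r, a))) in
  a''.1 = (r * \prod_(3 <= s < m.+3) I s + a'.1)%N :> nat /\ a''.2 = a'.2.
Proof.
have p_gt0 : (0 < p)%N.
  by case: p a => // -[a]; rewrite -bsizeE muln0 ltn0.
have eq_r : (r * bsize I p m = r * \prod_(3 <= s < m.+3) I s * p)%N.
  by rewrite -bsizeE mulnA.
split; last apply: val_inj.
  by rewrite -[LHS]/((r * bsize I p m + a) %/ p)%N eq_r divnMDl.
by rewrite -[LHS]/((r * bsize I p m + a) %% p)%N eq_r modnMDl.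
Qed.

Lemma bdiag_slab m (X : tensor C I m.+3) :
  bdiag X = \sum_r delta_mx r r *t bdiag (slab X r).
Proof.
apply/matrixP => a b; case: (mxtens_indexP a) => i i'.
case: (mxtens_indexP b) => j j'.
rewrite summxE; under eq_bigr do rewrite tensmxE mxE.
rewrite (bigD1 i) //= eqxx [X in _ + X]big1 ?addr0 => [|r neq_r]; last first.
  by rewrite eq_sym (negPf neq_r) mul0r.
rewrite !castmxE [LHS]mxE [block_matrix _ _ _]mxE.
have [i1 i2] := unindex_bsizeS i i'; have [j1 j2] := unindex_bsizeS j j'.
rewrite i2 j2 -val_eqE [X in X == _]i1 [X in _ == X]j1 eq_addl_mul ?ltn_ord //.
rewrite xpair_eqE !val_eqE [j == i]eq_sym.
have [_|_] := eqVneq i j; last by rewrite mxE mul0r.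
by rewrite mul1r /=; case: eqP => //; rewrite (rep_mx_slab X i1).
Qed.

Lemma bdiag_mode_prods (F : forall n, 'M[C]_n) m (X : tensor C I m.+3) :
  bdiag (mode_prods F X) =
  \sum_t diag_mx (\row_r F (I m.+3) r t) *t bdiag (mode_prods F (slab X t)).
Proof.
rewrite bdiag_slab; under eq_bigr do rewrite mode_prods_slab bdiag_sum.
apply/matrixP => a b; case: (mxtens_indexP a) => i i'.
case: (mxtens_indexP b) => j j'.
rewrite !summxE; under eq_bigr do rewrite tensmxE mxE summxE.
rewrite (bigD1 i) //= eqxx [X in _ + X]big1 ?addr0 => [|r neq_r]; last first.
  by rewrite eq_sym (negPf neq_r) mul0r.
rewrite mulr_sumr; apply: eq_bigr => t _.
by rewrite tensmxE !mxE mulrA mulr_natl eq_sym.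
Qed.

Lemma btph_slab m (X : tensor C I m.+3) :
  btph X = \sum_(t < I m.+3) (\matrix_(a < I m.+3, b < I m.+3)
    ((t == `|a%:Z - b%:Z|%N :> nat)%:R + (t == a + b + 1 :> nat)%N%:R
     + (t == 2 * I m.+3 - (a + b + 1) :> nat)%N%:R)) *t btph (slab X t).
Proof.
(* The value 0 out of range lets the case distinction in [btph] be written as a sum of two Hankel
   terms, at most one of which is in range. *)
pose blk k := if insub k is Some t then btph (slab X t) else 0 : 'M_(_, _).
have sum_blk k : \sum_(t < I m.+3) (t == k :> nat)%:R *: btph (slab X t) = blk k.
  rewrite /blk; case: insubP => [t _ <-|gek].
    rewrite (bigD1 t) //= eqxx scale1r big1 ?addr0 // => r.
    by rewrite -val_eqE => /negPf /= ->; rewrite scale0r.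
  rewrite big1 // => t _; rewrite ltn_eqF ?scale0r //.
  by apply: leq_trans (ltn_ord t) _; rewrite leqNgt.
have slice_blk k : (0 < k <= I m.+3)%N -> btph (slice X k) = blk k.-1.
  move=> /andP[k_gt0 lekn]; have ltk : (k.-1 < I m.+3)%N by rewrite prednK.
  by rewrite /blk /slice insubT.
apply/matrixP => a b; case: (mxtens_indexP a) => i i'.
case: (mxtens_indexP b) => j j'.
rewrite summxE; under eq_bigr do rewrite tensmxE mxE !mulrDl.
have [lti ltj] := (ltn_ord i, ltn_ord j).
have entry k : \sum_(t < I m.+3) (t == k :> nat)%:R * btph (slab X t) i' j' = blk k i' j'.
  by rewrite -sum_blk summxE; apply: eq_bigr => t _; rewrite mxE.
rewrite !big_split /= !entry [LHS]mxE !mxtens_indexK mxE -addrA.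
have blk0 k : (I m.+3 <= k)%N -> blk k = 0.
  by move=> lenk; rewrite /blk insubF // ltnNge lenk.
congr (_ + _) => /=.
  by rewrite slice_blk; [congr (fun_of_matrix (blk _) _ _)|]; lia.
case: ifP => [le_ij|gt_ij].
  rewrite [blk (_ - _)%N]blk0 ?mxE ?addr0; last by lia.
  by rewrite slice_blk; [congr (fun_of_matrix (blk _) _ _)|]; lia.
rewrite blk0 ?mxE ?add0r; last by lia.
case: ifP => [eq_ij|neq_ij]; first by rewrite blk0 ?mxE //; lia.
by rewrite slice_blk; [congr (fun_of_matrix (blk _) _ _)|]; lia.
Qed.

End Tensors.

(** * Invertibility of the outer factors and the induction on the order *)

Lemma kron_modes_unit (C : numClosedFieldType) (I : nat -> nat)
    (F : forall n, 'M[C]_n) p m :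
  (forall n, F n \in unitmx) -> kron_modes I F p m \in unitmx.
Proof.
move=> unitF; elim: m => [|m IHm] /=; first exact: unitmx1.
suff /mulmx1_unit[] : (F (I m.+3) *t kron_modes I F p m) *m
    (invmx (F (I m.+3)) *t invmx (kron_modes I F p m)) = 1%:M by [].
by rewrite tensmx_mul !mulmxV // tens1mx1.
Qed.

Lemma dctC_conj (R : realType) n :
  (@dctC R n ^t*)%sesqui = map_mx (real_complex R) (dct R n)^T.
Proof. by apply/matrixP => i j; rewrite !mxE; apply: conjc_real. Qed.

Lemma btph_bdiag (R : realType) m (I : nat -> nat) (X : tensor R[i] I m.+2) :
  btph X = kron_modes I (fun n => (@dctC R n ^t*)%sesqui) (I 1%N) m
    *m bdiag (dct_transform X) *m kron_modes I (@dctC R) (I 2%N) m.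
Proof.
elim: m X => [|m IHm] X.
  rewrite /= mul1mx mulmx1; apply/matrixP => a b.
  (* At order 2 the product of trailing dimensions is empty, so [bdiag] has the single block 0. *)
  have val0 (q : 'I_(\prod_(3 <= s < 3) I s)) : val q = 0%N.
    by case: q => q /=; rewrite big_geq // ltnS leqn0 => /eqP.
  rewrite castmxE [RHS]mxE -val_eqE [X in X == _]val0 [X in _ == X]val0 eqxx.
  rewrite /rep_mx; case: pickP => [k _|/(_ tt)]; last by rewrite [X in _ == X]val0.
  by rewrite !mxE; congr (X (_, _, _)); apply: val_inj; rewrite /= modn_small.
rewrite /dct_transform bdiag_mode_prods btph_slab mulmx_sumr mulmx_suml.
apply: eq_bigr => t _; rewrite /= !tensmx_mul -IHm; congr (_ *t _).
rewrite dctC_conj.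
have -> : diag_mx (\row_r dctMC R (I m.+3) r t) =
    map_mx (real_complex R) (diag_mx (\row_r dctM R (I m.+3) r t)).
  by rewrite map_diag_mx; congr diag_mx; apply/rowP => r; rewrite !mxE.
rewrite -!map_mxM; apply/matrixP => a b.
rewrite mxE [RHS]mxE dct_conj_diag_dctM.
by rewrite !rmorphD !rmorph_nat.
Qed.

(* The order is N = m.+3. *)
Theorem theorem3p3 (R : realType) (m : nat) (I : nat -> nat)
    (hI : forall n, (1 <= n <= m.+3)%N -> (0 < I n)%N)
    (X : tensor R[i] I m.+3) :
  let S := kron_modes I (fun n => (@dctC R n ^t*)%sesqui) (I 1%N) m.+1 in
  let T := kron_modes I (@dctC R) (I 2%N) m.+1 in
  [/\ S \in unitmx, T \in unitmx &
      btph X = S *m bdiag (dct_transform X) *m T].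
Proof.
have dctCV n : (@dctC R n ^t*)%sesqui *m @dctC R n = 1%:M.
  by rewrite dctC_conj -map_mxM dct_tr_mul map_mx1.
by split; [apply: kron_modes_unit => n; case/mulmx1_unit: (dctCV n)..
          |exact: btph_bdiag].
Qed.
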